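(* Let $0 < p < 2$ and suppose that $(\Omega, \mu)$ is a measure space. Let $x_{1}, \ldots, x_{n}, y_{1}, \ldots, y_{n}$ be given functions in $L_{p}(\Omega, \mu)$ such that the signed $(n,n)$-simplex $D = [x_{j}(1);y_{i}(1)]_{n,n}$ is non-degenerate. Then $$\sum_{1\le j_{1} < j_{2}\le n} \| x_{j_{1}} - x_{j_{2}} \|_{p}^{p} + \sum_{1\le i_{1} < i_{2}\le n} \| y_{i_{1}} - y_{i_{2}} \|_{p}^{p} = \sum_{j, i = 1}^{n} \| x_{j} - y_{i} \|_{p}^{p}$$ if and only if for almost every $\omega \in \Omega$, the numerical sets $\{ x_{k}(\omega) \}_{k=1}^{n}$ and $\{ y_{k}(\omega) \}_{k=1}^{n}$ are identical.
   Context: All measures are non-trivial and positive. $L_{p}(\Omega,\mu)$ is real or complex, carries the usual (quasi-)norm $\|f\|_p = (\int_\Omega |f|^p\,d\mu)^{1/p}$, and is assumed to be at least two-dimensional. A numerical set is a finite collection of possibly repeated real or complex numbers. Two numerical sets $\{\zeta_k\}_{k=1}^n$ and $\{\xi_k\}_{k=1}^n$ are identical if there is a permutation $\pi$ of $(1,\ldots,n)$ with $\zeta_{\pi(k)}=\xi_k$ for each $k$. The notation $D=[x_j(1);y_i(1)]_{n,n}$ means the configuration of (not necessarily distinct) points $x_1,\ldots,x_n,y_1,\ldots,y_n$ each carrying weight $1$. It is degenerate if for every $z\in\{x_1,\ldots,x_n,y_1,\ldots,y_n\}$ one has $|\{j:x_j=z\}|=|\{i:y_i=z\}|$ (equality of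 points meaning equality in $L_p(\Omega,\mu)$), and non-degenerate otherwise. *)

(* Defs.v *)
From mathcomp Require Import all_boot all_order all_algebra perm.
From mathcomp Require Import all_classical all_reals all_analysis.
From mathcomp Require Import complex.

Set Implicit Arguments.
Unset Strict Implicit.
Unset Printing Implicit Defensive.

Import Order.TTheory GRing.Theory Num.Theory.
Local Open Scope classical_set_scope.
Local Open Scope ring_scope.

Variant scalar_kind := RealScalars | ComplexScalars.

Definition scalars (R : realType) (k : scalar_kind) : numFieldType :=
  match k with
  | RealScalars => R
  | ComplexScalars => R[i]
  end.

Definition modulus (R : realType) (k : scalar_kind) : scalars R k -> R :=
  match k return scalars R k -> R with
  | RealScalars => fun z : R => `|z|
  | ComplexScalars => fun z : R[i] => complex.Re `|z|
  end.

(* A complex-valued function is Borel measurable iff its real and imaginary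
   parts are; R[i] carries no measurable structure in the library. *)
Definition measurable_scalar_fun (R : realType) (k : scalar_kind)
    (d : measure_display) (T : measurableType d) : (T -> scalars R k) -> Prop :=
  match k return (T -> scalars R k) -> Prop with
  | RealScalars => fun f : T -> R => measurable_fun [set: T] f
  | ComplexScalars => fun f : T -> R[i] =>
      measurable_fun [set: T] (fun w => complex.Re (f w)) /\
      measurable_fun [set: T] (fun w => complex.Im (f w))
  end.

Section Lp.
Context (R : realType) (k : scalar_kind).
Context (d : measure_display) (T : measurableType d).
Variables (mu : {measure set T -> \bar R}) (p : R).

(* The (quasi-)norm of L_p. It is finite exactly when f is p-integrable. *)
Definition Lp_norm (f : T -> scalars R k) : \bar R :=
  Lnorm mu p%:E (fun w => (modulus (f w))%:E).

(* Elements of L_p(mu) are represented by functions; two of them are the same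
   point of L_p(mu) when they agree mu-almost everywhere. (The library's L_p
   spaces are restricted to real scalars and p >= 1.) *)
Definition in_Lp (f : T -> scalars R k) : Prop :=
  measurable_scalar_fun f /\ (Lp_norm f < +oo)%E.

Definition Lp_eq (f g : T -> scalars R k) : Prop :=
  {ae mu, forall w, f w = g w}.

Definition Lp_dim_ge2 : Prop :=
  exists f g : T -> scalars R k, [/\ in_Lp f, in_Lp g &
    forall a b : scalars R k,
      Lp_eq (fun w => a * f w + b * g w) (fun=> 0) -> a = 0 /\ b = 0].

Definition degenerate (n : nat) (x y : 'I_n -> T -> scalars R k) : Prop :=
  forall z : T -> scalars R k,
    (exists j, z = x j) \/ (exists i, z = y i) ->
    #|[pred j | `[< Lp_eq (x j) z >]]| =
    #|[pred i | `[< Lp_eq (y i) z >]]|.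

End Lp.

Arguments Lp_dim_ge2 {R} k {d T} mu p.

Definition identical_numerical_sets (K : Type) (n : nat) (a b : 'I_n -> K) :
    Prop :=
  exists s : 'S_n, forall k, a (s k) = b k.

(* Main.v *)
Require Import Defs.
From mathcomp Require Import all_boot all_order all_algebra perm.
From mathcomp Require Import all_classical all_reals all_analysis.
From mathcomp Require Import measurable_realfun.
From mathcomp Require Import complex.
From mathcomp Require Import ring lra.

(* Write Q z for the signed sum of |z_i - z_j|^p over all pairs of points, with
   weight +1 on the x_j(w) and -1 on the y_i(w).  Since p/2 lies in (0, 1),
   |z|^p is a positive multiple of the integral over s > 0 of
   (1 - exp(- s |z|^2)) s^(- 1 - p/2), so that -Q is a mixture of Gaussian
   energies.  Expanding exp(2 s <z_i, z_j>) as a power series shows that a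
   Gaussian energy is a nonnegative combination of squares of moments; if it
   vanishes, all moments of the signed point measure vanish, and evaluating
   complex polynomials shows that the measure is zero.  Hence the difference of
   the two sides has a pointwise nonnegative integrand, which vanishes exactly
   where the two numerical sets are identical. *)

Set Implicit Arguments.
Unset Strict Implicit.
Unset Printing Implicit Defensive.

Import Order.TTheory GRing.Theory Num.Theory.
Import numFieldNormedType.Exports.
Local Open Scope classical_set_scope.
Local Open Scope ring_scope.

(** * Positivity of the exponential of the inner product in the plane *)

Section GaussianKernel.
Context (R : realType) (I : finType).
Implicit Types (c d u v : I -> R).

(** The binomial theorem separates the indices: each monomial of the inner product power is a factor
    in [i] times the same factor in [j], so the double sum splits into squared moments. *)
Lemma double_sum_inner_exp d u v k :
  \sum_i \sum_j d i * d j * (u i * u j + v i * v j) ^+ k =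
  \sum_(l < k.+1) (\sum_i d i * (u i ^+ (k - l) * v i ^+ l)) ^+ 2 *+ 'C(k, l).
Proof.
transitivity (\sum_i \sum_j \sum_(l < k.+1)
    (d i * (u i ^+ (k - l) * v i ^+ l)) *
    (d j * (u j ^+ (k - l) * v j ^+ l)) *+ 'C(k, l)).
  apply: eq_bigr => i _; apply: eq_bigr => j _.
  rewrite exprDn mulr_sumr; apply: eq_bigr => l _.
  rewrite mulrnAr !exprMn; congr (_ *+ _); ring.
under eq_bigr do rewrite exchange_big /=.
rewrite exchange_big /=; apply: eq_bigr => l _.
rewrite expr2 mulr_suml -sumrMnl; apply: eq_bigr => i _.
by rewrite mulr_sumr -sumrMnl.
Qed.

Lemma double_sum_inner_exp_ge0 d u v k :
  0 <= \sum_i \sum_j d i * d j * (u i * u j + v i * v j) ^+ k.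
Proof.
by rewrite double_sum_inner_exp sumr_ge0// => l _; rewrite mulrn_wge0// sqr_ge0.
Qed.

Lemma cvg_expR_kernel d u v (s : R) :
  \sum_(k < n) s ^+ k / k`!%:R *
    \sum_i \sum_j d i * d j * (u i * u j + v i * v j) ^+ k @[n --> \oo] -->
  \sum_i \sum_j d i * d j * expR (s * (u i * u j + v i * v j)).
Proof.
have -> : (fun n => \sum_(k < n) s ^+ k / k`!%:R *
    \sum_i \sum_j d i * d j * (u i * u j + v i * v j) ^+ k) =
  (fun n => \sum_i \sum_j d i * d j *
    series (exp_coeff (s * (u i * u j + v i * v j))) n).
  apply/funext => n.
  under eq_bigr do rewrite mulr_sumr; rewrite exchange_big; apply: eq_bigr => i _.
  under eq_bigr do rewrite mulr_sumr; rewrite exchange_big; apply: eq_bigr => j _.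
  rewrite /series /= big_mkord mulr_sumr; apply: eq_bigr => k _.
  by rewrite /exp_coeff /= exprMn; ring.
apply: (cvg_big add_continuous) => // i _.
apply: (cvg_big add_continuous) => // j _.
apply: cvgMl_tmp; exact: is_cvg_series_exp_coeff.
Qed.

(** The power series has nonnegative terms, so [K] dominates every partial sum. If [K = 0], every
    term vanishes, and the term of degree [a + b] contains the square of the moment with exponents
    [a] and [b]. *)
Lemma expR_kernel_ge0_eq0 d u v (s : R) : 0 < s ->
  let K := \sum_i \sum_j d i * d j * expR (s * (u i * u j + v i * v j)) in
  0 <= K /\ (K = 0 -> forall a b, \sum_i d i * (u i ^+ a * v i ^+ b) = 0).
Proof.
move=> s0 K.
pose t k := s ^+ k / k`!%:R *
    \sum_i \sum_j d i * d j * (u i * u j + v i * v j) ^+ k.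
have w0 k : 0 < s ^+ k / k`!%:R by rewrite divr_gt0 ?exprn_gt0// ltr0n fact_gt0.
have t0 k : 0 <= t k by rewrite mulr_ge0 ?double_sum_inner_exp_ge0// ltW.
have tK : \sum_(k < n) t k @[n --> \oo] --> K by exact: cvg_expR_kernel.
have tleK n : \sum_(k < n) t k <= K.
  rewrite -(cvg_lim (@Rhausdorff R) tK).
  apply: (@nondecreasing_cvgn_le R (fun n => \sum_(k < n) t k)); last exact: cvgP tK.
  by apply/nondecreasing_seqP => m; rewrite big_ord_recr lerDl t0.
split; first by have := tleK 0%N; rewrite big_ord0.
move=> K0 a b.
have : t (a + b)%N = 0.
  apply/eqP; rewrite eq_le t0 andbT.
  have := tleK (a + b).+1; rewrite K0 big_ord_recr /=; apply: le_trans.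
  by rewrite lerDr sumr_ge0.
move/eqP; rewrite mulf_eq0 (gt_eqF (w0 _))/= double_sum_inner_exp => /eqP.
move/psumr_eq0P => /(_ (fun l _ => mulrn_wge0 _ (sqr_ge0 _))).
(* The summand [l = b] has exponents [a + b - b = a] and [b], with a positive binomial
   coefficient. *)
have bab : (b < (a + b).+1)%N by rewrite ltnS leq_addl.
move=> /(_ (Ordinal bab) isT) /= /eqP.
rewrite addnK mulrn_eq0 -leqn0 leqNgt bin_gt0 leq_addl /= sqrf_eq0.
by move/eqP.
Qed.

End GaussianKernel.

(** * Recovering point masses from moments *)

Section SeparationByMoments.
Context (R : realType) (I : finType).
Local Open Scope complex_scope.

(** Powers of the complex number with coordinates [u i], [v i] expand into real monomials, so only
    the given moments occur. *)
Lemma moments_eq0_horner (d u v : I -> R) (P : {poly R[i]}) :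
  (forall a b, \sum_i d i * (u i ^+ a * v i ^+ b) = 0) ->
  \sum_i (d i)%:C * P.[u i +i* v i] = 0.
Proof.
move=> m0.
under eq_bigr do rewrite horner_coef mulr_sumr.
rewrite exchange_big /= big1// => k _.
under eq_bigr do rewrite mulrCA.
rewrite -mulr_sumr.
suff -> : \sum_i (d i)%:C * (u i +i* v i) ^+ k = 0 by rewrite mulr0.
have zE i : u i +i* v i = (u i)%:C + 'i * (v i)%:C.
  by simpc.
under eq_bigr do rewrite zE exprDn mulr_sumr.
rewrite exchange_big big1// => l _.
transitivity ('i ^+ l *+ 'C(k, l) * (\sum_i d i * (u i ^+ (k - l) * v i ^+ l))%:C :> R[i]).
  rewrite rmorph_sum mulr_sumr; apply: eq_bigr => i _.
  rewrite !rmorphM !rmorphXn /= exprMn mulrnAr mulrnAl; congr (_ *+ _); ring.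
by rewrite m0 rmorph0 mulr0.
Qed.

(** Testing against a polynomial that vanishes at all points other than [w], but not at [w],
    isolates the mass at [w]. Viewing the plane as complex numbers makes one variable enough. *)
Lemma moments_eq0_fiber (d u v : I -> R) (a b : R) :
  (forall k l, \sum_i d i * (u i ^+ k * v i ^+ l) = 0) ->
  \sum_(i | (u i == a) && (v i == b)) d i = 0.
Proof.
move=> m0.
pose z i : R[i] := u i +i* v i; pose w : R[i] := a +i* b.
pose P : {poly R[i]} := \prod_(i | z i != w) ('X - (z i)%:P).
have Pz i : z i != w -> P.[z i] = 0.
  by move=> ziw; rewrite horner_prod (bigD1 i)//= hornerXsubC subrr mul0r.
have Pw : P.[w] != 0.
  rewrite horner_prod; apply/prodf_neq0 => i ziw.
  by rewrite hornerXsubC subr_eq0 eq_sym.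
have := moments_eq0_horner P m0.
rewrite (bigID (fun i => z i == w)) /= [X in _ + X]big1 => [|i /Pz ->]; last first.
  by rewrite mulr0.
rewrite addr0 (eq_bigr (fun i => (d i)%:C * P.[w])); last first.
  by move=> i /eqP <-.
rewrite -mulr_suml => /eqP; rewrite mulf_eq0 (negbTE Pw) orbF.
rewrite -rmorph_sum /= => /eqP[]; under eq_bigl do rewrite eq_complex.
by [].
Qed.

End SeparationByMoments.

(** Expanding the squared distance turns the Gaussian into the exponential kernel with parameter
    [2 * s] and rescaled weights [d]. The rescaling is constant and positive on each fiber, so the
    nonzero mass at [(a, b)] persists and excludes a zero energy. *)
Lemma gaussian_kernel_gt0 (R : realType) (I : finType) (c u v : I -> R) (a b s : R) :
  0 < s -> \sum_(i | (u i == a) && (v i == b)) c i != 0 ->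
  0 < \sum_i \sum_j c i * c j *
        expR (- (s * ((u i - u j) ^+ 2 + (v i - v j) ^+ 2))).
Proof.
move=> s0 cab.
pose d i := c i * expR (- (s * (u i ^+ 2 + v i ^+ 2))).
have -> : \sum_i \sum_j c i * c j *
        expR (- (s * ((u i - u j) ^+ 2 + (v i - v j) ^+ 2))) =
   \sum_i \sum_j d i * d j * expR (2 * s * (u i * u j + v i * v j)).
  apply: eq_bigr => i _; apply: eq_bigr => j _.
  rewrite /d mulrACA -[RHS]mulrA -!expRD; congr (_ * expR _); ring.
have [|K0 Keq0] := @expR_kernel_ge0_eq0 R I d u v (2 * s).
  by rewrite mulr_gt0.
rewrite lt_neqAle K0 andbT eq_sym; apply: contra_neq cab => /Keq0.
move=> /(@moments_eq0_fiber _ _ d u v a b).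
rewrite (eq_bigr (fun i => c i * expR (- (s * (a ^+ 2 + b ^+ 2))))); last first.
  by move=> i /andP[/eqP <- /eqP <-].
by rewrite -mulr_suml => /eqP; rewrite mulf_eq0 expR_eq0 orbF => /eqP.
Qed.

(** * Powers with exponent in (0, 1) as integrals of exponentials *)

Section PowerAsMixture.
Context (R : realType).
Implicit Types q r t u : R.
Let mu := @lebesgue_measure R.

(** A zero integral would force [f] to vanish almost everywhere, making the unit interval a null
    set. *)
Lemma Rintegral_gt0 (f : R -> R) :
  mu.-integrable [set: R] (EFin \o f) -> (forall x, 0 < f x) ->
  0 < \int[mu]_x f x.
Proof.
move=> fint f0; rewrite lt_neqAle Rintegral_ge0 ?andbT; last first.
  by move=> x _; exact: ltW.
apply/negP => /eqP int0.
have mf := measurable_int mu fint.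
have : (\int[mu]_x `|(EFin \o f) x| = 0)%E.
  under eq_integral do rewrite gee0_abs ?lee_fin ?ltW//.
  by rewrite -[LHS]fineK ?integrable_fin_num// -[fine _]int0.
move/(ae_eq_integral_abs mu measurableT mf) => [N [mN N0 subN]].
have : mu `[0%R, 1%R] = 0%E.
  apply: (@subset_measure0 _ _ _ _ _ N) => // x _; apply: subN => /= /(_ I) [] fx0.
  by have := f0 x; rewrite fx0 ltxx.
by rewrite /mu lebesgue_measure_itv /= lte01 oppr0 adde0 => -[] /eqP; rewrite oner_eq0.
Qed.

(** This function will dominate [laplace_integrand]. By evenness it reduces to the half line, where
    it is a multiple of an exponential density. *)
Lemma integrable_expRN_norm r : 0 < r ->
  mu.-integrable [set: R] (EFin \o (fun u => expR (- (r * `|u|)))).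
Proof.
move=> r0.
have cf : continuous (fun u => expR (- (r * `|u|))).
  move=> u; apply: continuous_comp; last exact: continuous_expR.
  apply: cvgN; apply: cvgMl_tmp; exact: norm_continuous.
have mf : measurable_fun [set: R] (EFin \o (fun u => expR (- (r * `|u|)))).
  by apply/measurable_EFinP; exact: continuous_measurable_fun.
apply/integrableP; split => //.
under eq_integral do rewrite gee0_abs ?lee_fin ?expR_ge0//.
rewrite ge0_symfun_integralT//=; last by move=> u /=; rewrite normrN.
apply: lte_mul_pinfty => //; rewrite -set_itvcy.
have -> : (\int[mu]_(u in `[0%R, +oo[) (expR (- (r * `|u|)))%:E =
    \int[mu]_(u in `[0%R, +oo[) (r^-1%:E * (exponential_pdf r u)%:E))%E.
  apply: eq_integral => u; rewrite inE /= in_itv/= andbT => u0.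
  rewrite exponential_pdfE// -EFinM ger0_norm// mulrA.
  by rewrite mulVf ?gt_eqF// mul1r mulNr.
have pint : mu.-integrable `[0, +oo[ (EFin \o exponential_pdf r).
  apply: integrableS (integrable_exponential_pdf r0) => //.
rewrite integralZl//; apply: lte_mul_pinfty; rewrite ?lee_fin ?invr_ge0 ?ltW//.
exact: integral_fune_lt_pinfty.
Qed.

(* [(1 - exp(- t s)) s^(- 1 - q) ds] after the substitution [s = expR u], under
   which a dilation of [t] becomes a translation of [u]. *)
Definition laplace_integrand q t u :=
  (1 - expR (- (t * expR u))) * expR (- (q * u)).

Lemma laplace_integrand_ge0 q t u : 0 <= t -> 0 <= laplace_integrand q t u.
Proof.
move=> t0; rewrite mulr_ge0 ?expR_ge0// subr_ge0 expR_le1 oppr_le0.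
by rewrite mulr_ge0 ?expR_ge0.
Qed.

Lemma continuous_laplace_integrand q t : continuous (laplace_integrand q t).
Proof.
move=> u; apply: cvgM.
  apply: cvgB; first exact: cvg_cst.
  apply: continuous_comp; last exact: continuous_expR.
  by apply: cvgN; apply: cvgMl_tmp; exact: continuous_expR.
apply: continuous_comp; last exact: continuous_expR.
by apply: cvgN; apply: cvgMl_tmp; exact: cvg_id.
Qed.

(** For [0 <= u], bounding [1 - exp(- x)] by 1 leaves decay at rate [q]. For [u < 0], bounding it by
    [x] gains a factor [expR u], which leaves decay at rate [1 - q]. *)
Lemma laplace_integrand_le q t u : 0 < q < 1 -> 0 <= t ->
  laplace_integrand q t u <=
    (1 + t) * expR (- (Num.min q (1 - q) * `|u|)).
Proof.
move=> /andP[q0 q1] t0; rewrite /laplace_integrand.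
have [u0|u0] := leP 0 u.
  apply: ler_pM; rewrite ?expR_ge0//.
  - by rewrite subr_ge0 expR_le1 oppr_le0 mulr_ge0 ?expR_ge0.
  - by have := expR_ge0 (- (t * expR u)); lra.
  - rewrite ler_expR lerN2 ger0_norm// ler_wpM2r// ge_min lexx//.
(* The factor [expR u] is split off to match the bound of [1 - exp(- x)] by [x = t * expR u]. *)
have -> : (1 + t) * expR (- (Num.min q (1 - q) * `|u|)) =
  ((1 + t) * expR u) * expR (- (u + Num.min q (1 - q) * `|u|)).
  by rewrite -mulrA -expRD; congr (_ * expR _); ring.
apply: ler_pM; rewrite ?expR_ge0//.
- by rewrite subr_ge0 expR_le1 oppr_le0 mulr_ge0 ?expR_ge0.
- have := expR_ge1Dx (- (t * expR u)); have := expR_ge0 u; lra.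
- rewrite ler_expR lerN2 ltr0_norm//.
  have : Num.min q (1 - q) <= 1 - q by rewrite ge_min lexx orbT.
  nra.
Qed.

Lemma integrable_laplace_integrand q t : 0 < q < 1 -> 0 <= t ->
  mu.-integrable [set: R] (EFin \o laplace_integrand q t).
Proof.
move=> q01 t0; have /andP[q0 q1] := q01.
apply: (@le_integrable _ _ _ mu _ measurableT _
  (fun u => (1 + t)%:E * (expR (- (Num.min q (1 - q) * `|u|)))%:E)%E).
- apply/measurable_EFinP; apply: continuous_measurable_fun.
  exact: continuous_laplace_integrand.
- move=> u _ /=; rewrite lee_fin ger0_norm ?laplace_integrand_ge0//.
  by rewrite ger0_norm ?laplace_integrand_le// mulr_ge0 ?expR_ge0// addr_ge0.
- apply: integrableZl => //; apply: integrable_expRN_norm.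
  by rewrite lt_min q0 subr_gt0.
Qed.

(** Translating [u] by [ln t] replaces [expR u] by [t * expR u], and the other exponential yields a
    factor that cancels the power of [t]. *)
Lemma powR_laplace q t : 0 < q < 1 -> 0 <= t ->
  t `^ q * \int[mu]_u laplace_integrand q 1 u =
  \int[mu]_u laplace_integrand q t u.
Proof.
move=> q01; rewrite le_eqVlt => /predU1P[<-|t0].
  (* At [t = 0] both sides vanish; [q != 0] matters because zero to the power zero is 1. *)
  rewrite powR0 ?mul0r; last by case/andP: q01 => /gt_eqF ->.
  under eq_Rintegral do rewrite /laplace_integrand mul0r oppr0 expR0 subrr mul0r.
  by rewrite /Rintegral integral0.
rewrite -RintegralZl//; last exact: integrable_laplace_integrand.
pose a := ln t; have ta : t = expR a by rewrite lnK.
rewrite /Rintegral; congr fine.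
have d1 : derive1 (fun x : R => x + a) = cst 1.
  by apply/funext => x; rewrite derive1E deriveD// derive_cst addr0 derive_id.
rewrite (@increasing_ge0_integration_by_substitutionT _ (fun x => x + a)
   (fun u => t `^ q * laplace_integrand q 1 u)) ?d1//.
- apply: eq_integral => u _; congr EFin.
  rewrite fctE /= mulr1 /laplace_integrand mul1r ta.
  rewrite -expRM -expRD [a + u]addrC mulrCA -expRD; congr (_ * expR _).
  by ring.
- by move=> x y xy; rewrite ltrD2r.
- by move=> x; exact: cvg_cst.
- exact: is_cvg_cst.
- exact: is_cvg_cst.
- by apply: cvg_addrr_Ny.
- by apply: cvg_addrr.
- by move=> u; apply: cvgMl_tmp; exact: continuous_laplace_integrand.
- by move=> u; rewrite mulr_ge0 ?powR_ge0// laplace_integrand_ge0.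
Qed.

End PowerAsMixture.

(** By [powR_laplace], the sum times the positive constant [G] is minus the integral of [h]. Zero
    total mass removes the constant from [1 - exp], so [h s] is a positive multiple of the Gaussian
    energy with parameter [expR s]. *)
Lemma power_kernel_lt0 (R : realType) (I : finType) (c u v : I -> R)
    (a b q : R) :
  0 < q < 1 -> \sum_i c i = 0 ->
  \sum_(i | (u i == a) && (v i == b)) c i != 0 ->
  \sum_i \sum_j c i * c j * ((u i - u j) ^+ 2 + (v i - v j) ^+ 2) `^ q < 0.
Proof.
move=> q01 c0 cab; set mu := @lebesgue_measure R.
pose t i j := (u i - u j) ^+ 2 + (v i - v j) ^+ 2.
have t0 i j : 0 <= t i j by rewrite addr_ge0 ?sqr_ge0.
set G := \int[mu]_s laplace_integrand q 1 s.
have G0 : 0 < G.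
  apply: Rintegral_gt0; first exact: integrable_laplace_integrand.
  move=> s; rewrite mulr_gt0 ?expR_gt0// subr_gt0 expR_lt1 oppr_lt0.
  by rewrite mulr_gt0 ?expR_gt0.
pose h s := \sum_i \sum_j - (c i * c j) * laplace_integrand q (t i j) s.
have hint0 i j : mu.-integrable [set: R]
    (fun s => (- (c i * c j) * laplace_integrand q (t i j) s)%:E).
  under eq_fun do rewrite EFinM.
  by apply: integrableZl => //; exact: integrable_laplace_integrand.
have hE : EFin \o h = (fun s =>
    \sum_i \sum_j (- (c i * c j) * laplace_integrand q (t i j) s)%:E)%E.
  apply/funext => s; rewrite /h /= -sumEFin; apply: eq_bigr => i _.
  by rewrite sumEFin.
have hint1 i : mu.-integrable [set: R] (fun s =>
    \sum_j (- (c i * c j) * laplace_integrand q (t i j) s)%:E)%E.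
  by apply: integrable_sum => // j _; exact: hint0.
have hint : mu.-integrable [set: R] (EFin \o h).
  by rewrite hE; apply: integrable_sum => // i _.
have h0 s : 0 < h s.
  have := @gaussian_kernel_gt0 R I c u v a b (expR s) (expR_gt0 _) cab.
  rewrite -(pmulr_lgt0 _ (expR_gt0 (- (q * s)))).
  suff -> : h s = (\sum_i \sum_j c i * c j * expR (- (expR s * t i j))) *
    expR (- (q * s)) by [].
  have -> : h s = (\sum_i \sum_j (c i * c j * expR (- (expR s * t i j)) -
    c i * c j)) * expR (- (q * s)).
    rewrite /h mulr_suml; apply: eq_bigr => i _; rewrite mulr_suml; apply: eq_bigr => j _.
    by rewrite /laplace_integrand (mulrC (t i j)); ring.
  (* Summed over [j], the constant terms give [c i] times the total mass, which is zero. *)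
  congr (_ * _); under eq_bigr do rewrite sumrB -mulr_sumr c0 mulr0 subr0.
  by [].
have tint i j : (\int[mu]_s (- (c i * c j) * laplace_integrand q (t i j) s)%:E =
    (- (c i * c j) * (t i j `^ q * G))%:E)%E.
  rewrite /G powR_laplace// -RintegralZl//; last exact: integrable_laplace_integrand.
  by rewrite /Rintegral fineK// integrable_fin_num.
have := Rintegral_gt0 hint h0.
rewrite /Rintegral; have -> : (\int[mu]_s (h s)%:E)%E =
    (\sum_i \sum_j - (c i * c j) * (t i j `^ q * G))%:E.
  rewrite -[LHS]/(\int[mu]_s ((EFin \o h) s))%E hE integral_sum// -sumEFin.
  apply: eq_bigr => i _; rewrite integral_sum// -sumEFin.
  by apply: eq_bigr => j _; exact: tint.
rewrite /=; set S := (X in X < 0).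
have -> : \sum_i \sum_j - (c i * c j) * (t i j `^ q * G) = - S * G.
  rewrite /S -sumrN mulr_suml; apply: eq_bigr => i _.
  by rewrite -sumrN mulr_suml; apply: eq_bigr => j _; rewrite /t; ring.
by rewrite pmulr_lgt0// oppr_gt0.
Qed.

(** * Planar coordinates of real and complex scalars *)

Section Coordinates.
Context (R : realType) (k : scalar_kind).
Implicit Types z w : scalars R k.

(** Real scalars are placed in the plane with second coordinate zero, so that one planar argument
    serves both kinds. *)
Definition scalar_re : scalars R k -> R :=
  match k return scalars R k -> R with
  | RealScalars => id
  | ComplexScalars => @complex.Re R
  end.

Definition scalar_im : scalars R k -> R :=
  match k return scalars R k -> R with
  | RealScalars => cst 0
  | ComplexScalars => @complex.Im R
  end.

Lemma scalar_reB z w : scalar_re (z - w) = scalar_re z - scalar_re w.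
Proof. by rewrite /scalar_re; case: k z w => [|] // z w; rewrite raddfB. Qed.

Lemma scalar_imB z w : scalar_im (z - w) = scalar_im z - scalar_im w.
Proof.
by rewrite /scalar_im; case: k z w => [|] z w; rewrite ?raddfB //= subr0.
Qed.

Lemma eq_scalar z w :
  (z == w) = (scalar_re z == scalar_re w) && (scalar_im z == scalar_im w).
Proof.
rewrite /scalar_re /scalar_im; case: k z w => [|] z w; last exact: eq_complex.
by rewrite eqxx andbT.
Qed.

Lemma modulus_powR z (p : R) : p != 0 ->
  modulus z `^ p = (scalar_re z ^+ 2 + scalar_im z ^+ 2) `^ (p / 2).
Proof.
move=> p0.
have sqrtE (t : R) : 0 <= t -> Num.sqrt t `^ p = t `^ (p / 2).
  by move=> t0; rewrite -powR12_sqrt// -powRrM mulrC.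
rewrite -sqrtE ?addr_ge0 ?sqr_ge0// /modulus /scalar_re /scalar_im.
case: k z => [|] z; last by rewrite normc_def.
by rewrite expr0n addr0 sqrtr_sqr.
Qed.

Lemma modulus_ge0 z : 0 <= modulus z.
Proof. by rewrite /modulus; case: k z => [|] z; rewrite ?normc_def ?sqrtr_ge0. Qed.

Lemma modulus0 : modulus (0 : scalars R k) = 0.
Proof. by rewrite /modulus; case: k; rewrite normr0. Qed.

Lemma ler_modulusB z w : modulus (z - w) <= modulus z + modulus w.
Proof.
rewrite /modulus; case: k z w => [|] z w; first exact: ler_normB.
by rewrite -raddfD; have := ler_normB z w; rewrite lecE => /andP[].
Qed.

Lemma modulusBC z w : modulus (z - w) = modulus (w - z).
Proof. by rewrite /modulus; case: k z w => [|] z w; rewrite distrC. Qed.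

(** The modulus of the difference is at most twice the larger modulus, whose power is one of the two
    summands. No convexity enters, so exponents below 1 are covered. *)
Lemma modulusB_powR_le z w (p : R) : 0 <= p ->
  modulus (z - w) `^ p <= 2 `^ p * (modulus z `^ p + modulus w `^ p).
Proof.
move=> p0; pose m := Num.max (modulus z) (modulus w).
have m0 : 0 <= m by rewrite le_max modulus_ge0.
apply: (@le_trans _ _ ((2 * m) `^ p)).
  rewrite ge0_ler_powR ?nnegrE ?modulus_ge0 ?mulr_ge0//.
  rewrite (le_trans (ler_modulusB z w))//.
  by rewrite mulr_natl mulr2n lerD// le_max lexx ?orbT.
rewrite powRM// ler_wpM2l ?powR_ge0// /m.
by have [_|_] := leP (modulus z) (modulus w); rewrite ?lerDl ?lerDr powR_ge0.
Qed.

End Coordinates.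

(** * Energies of two finite families of scalars *)

Lemma double_sum_symmetric (V : nmodType) (n : nat) (f : 'I_n -> 'I_n -> V) :
  (forall i, f i i = 0) -> (forall i j, f i j = f j i) ->
  \sum_i \sum_j f i j = (\sum_(i < n) \sum_(j < n | (i < j)%N) f i j) *+ 2.
Proof.
move=> f0 fC.
have -> : \sum_i \sum_j f i j = \sum_(i < n) \sum_(j < n | (i < j)%N) f i j +
    \sum_(i < n) \sum_(j < n | (j < i)%N) f i j.
  rewrite -big_split; apply: eq_bigr => i _.
  rewrite (bigID (fun j : 'I_n => (i < j)%N)) /=; congr (_ + _).
  rewrite (bigID (fun j => j == i)) /= big1 => [|j /andP[_ /eqP ->]//].
  rewrite add0r; apply: eq_bigl => j; rewrite -leqNgt andbC.
  by rewrite [RHS]ltn_neqAle.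
rewrite [X in _ + X](exchange_big_dep predT)//= mulr2n; congr (_ + _).
by apply: eq_bigr => i _; apply: eq_bigr => j _.
Qed.

Section ScalarEnergy.
Context (R : realType) (k : scalar_kind) (n : nat) (p : R).
Implicit Types a b : 'I_n -> scalars R k.

Definition intra_energy a : R :=
  \sum_(i < n) \sum_(j < n | (i < j)%N) modulus (a i - a j) `^ p.

Definition cross_energy a b : R :=
  \sum_(i < n) \sum_(j < n) modulus (a i - b j) `^ p.

Lemma cross_energy_diag a : p != 0 ->
  cross_energy a a = intra_energy a *+ 2.
Proof.
move=> p0; apply: double_sum_symmetric => [i|i j]; last by rewrite modulusBC.
by rewrite subrr modulus0 powR0.
Qed.

(** Reindexing by the permutation makes the full double sums for [(a, a)], [(a, b)] and [(b, b)]
    equal; the first and last are twice the intra energies. *)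
Lemma identical_energy a b : p != 0 -> identical_numerical_sets a b ->
  intra_energy a + intra_energy b = cross_energy a b.
Proof.
move=> p0 [s ab].
have bE : b = a \o s by apply/funext => i; rewrite /= ab.
have crossb : cross_energy a b = cross_energy a a.
  apply: eq_bigr => i _; rewrite bE [RHS](reindex_inj (@perm_inj _ s)).
  by [].
have crossbb : cross_energy b b = cross_energy a b.
  rewrite [RHS](reindex_inj (@perm_inj _ s)).
  by apply: eq_bigr => i _; apply: eq_bigr => j _; rewrite ab.
have : intra_energy a *+ 2 = intra_energy b *+ 2.
  by rewrite -!cross_energy_diag// crossbb crossb.
move/eqP; rewrite eqrMn2r//= => /eqP e.
by rewrite -e crossb cross_energy_diag// mulr2n.
Qed.

Lemma identical_numerical_sets_count a b :
  (forall z, #|[pred i | a i == z]| = #|[pred i | b i == z]|) ->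
  identical_numerical_sets a b.
Proof.
move=> cab.
(* On tuples of values, [perm_eq] is checked by multiplicities and [tuple_permP] then supplies the
   permutation. *)
have /tuple_permP[s sE] : perm_eq [tuple b i | i < n] [tuple a i | i < n].
  have cardE' (f : 'I_n -> scalars R k) z :
      count_mem z [tuple f i | i < n] = #|[pred i | f i == z]|.
    rewrite count_map -sum1_count -sum1_card big_enum_cond.
    by apply: eq_bigl => i; rewrite !inE.
  by apply/allP => z _; rewrite /= !cardE' cab.
exists s => i.
have := congr1 (fun t => nth 0 t i) sE.
by rewrite -!tnth_nth !tnth_mktuple => ->.
Qed.

(** [power_kernel_lt0] is applied to all [2n] points, with weight 1 on [a] and -1 on [b]. The total
    mass is zero, and the exponent is [p / 2] because the kernel takes squared distances. *)
Lemma nonidentical_energy a b : 0 < p < 2 -> ~ identical_numerical_sets a b ->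
  intra_energy a + intra_energy b < cross_energy a b.
Proof.
move=> /andP[p0 p2] nab.
have pN0 : p != 0 by rewrite gt_eqF.
(* Some value has different multiplicities in [a] and [b]; counting in [R] lets the difference be
   read as the signed mass at [z]. *)
have [z cz] : exists z, \sum_(i < n | a i == z) (1 : R) != \sum_(i < n | b i == z) 1.
  apply: contrapT => /forallNP nz; apply: nab.
  apply: identical_numerical_sets_count => z; move/negP: (nz z).
  have sumE (f : 'I_n -> scalars R k) :
    \sum_(i < n | f i == z) (1 : R) = #|[pred i | f i == z]|%:R by rewrite -sumr_const.
  by rewrite negbK !sumE eqr_nat => /eqP.
pose pt (x : 'I_n + 'I_n) := match x with inl i => a i | inr i => b i end.
pose c (x : 'I_n + 'I_n) : R := match x with inl i => 1 | inr i => -1 end.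
have := @power_kernel_lt0 R _ c (fun x => scalar_re (pt x)) (fun x => scalar_im (pt x))
  (scalar_re z) (scalar_im z) (p / 2).
under [in X in _ -> _ -> X -> _]eq_bigl do rewrite -eq_scalar.
rewrite !big_sumType /=.
rewrite !sumrN subrr subr_eq0 => /(_ _ erefl cz).
rewrite divr_gt0// ltr_pdivrMr// mul1r p2 => /(_ isT).
under eq_bigr do rewrite big_sumType /=.
under [X in _ + X < _]eq_bigr do rewrite big_sumType /=.
rewrite !big_split /=.
have E (z1 z2 : scalars R k) : ((scalar_re z1 - scalar_re z2) ^+ 2 +
    (scalar_im z1 - scalar_im z2) ^+ 2) `^ (p / 2) = modulus (z1 - z2) `^ p.
  by rewrite modulus_powR// scalar_reB scalar_imB.
(* The four blocks of the signed sum give twice each intra energy and minus the cross energy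
   twice. *)
have -> : \sum_i \sum_j 1 * 1 * ((scalar_re (a i) - scalar_re (a j)) ^+ 2 +
    (scalar_im (a i) - scalar_im (a j)) ^+ 2) `^ (p / 2) = intra_energy a *+ 2.
  rewrite -cross_energy_diag//; apply: eq_bigr => i _; apply: eq_bigr => j _.
  by rewrite !mul1r E.
have -> : \sum_i \sum_j 1 * -1 * ((scalar_re (a i) - scalar_re (b j)) ^+ 2 +
    (scalar_im (a i) - scalar_im (b j)) ^+ 2) `^ (p / 2) = - cross_energy a b.
  rewrite -sumrN; apply: eq_bigr => i _; rewrite -sumrN; apply: eq_bigr => j _.
  by rewrite mul1r mulN1r E.
have -> : \sum_i \sum_j -1 * 1 * ((scalar_re (b i) - scalar_re (a j)) ^+ 2 +
    (scalar_im (b i) - scalar_im (a j)) ^+ 2) `^ (p / 2) = - cross_energy a b.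
  rewrite exchange_big -sumrN; apply: eq_bigr => i _; rewrite -sumrN; apply: eq_bigr => j _.
  by rewrite mulr1 mulN1r E modulusBC.
have -> : \sum_i \sum_j -1 * -1 * ((scalar_re (b i) - scalar_re (b j)) ^+ 2 +
    (scalar_im (b i) - scalar_im (b j)) ^+ 2) `^ (p / 2) = intra_energy b *+ 2.
  rewrite -cross_energy_diag//; apply: eq_bigr => i _; apply: eq_bigr => j _.
  by rewrite mulrNN !mul1r E.
by lra.
Qed.

Lemma energy_eqP a b : 0 < p < 2 ->
  intra_energy a + intra_energy b = cross_energy a b <->
  identical_numerical_sets a b.
Proof.
move=> p02; split => [e|]; last first.
  by apply: identical_energy; case/andP: p02 => /gt_eqF ->.
apply: contrapT => /(nonidentical_energy p02).
by rewrite e ltxx.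
Qed.

Lemma energy_le a b : 0 < p < 2 ->
  intra_energy a + intra_energy b <= cross_energy a b.
Proof.
move=> p02; have [/(energy_eqP a b p02) ->//|] := pselect (identical_numerical_sets a b).
by move/(nonidentical_energy p02)/ltW.
Qed.

End ScalarEnergy.

(** * From pointwise inequalities to integrals *)

Section MeasureLevel.
Context (R : realType) d (T : measurableType d) (mu : {measure set T -> \bar R}).

(** Integrability keeps both integrals finite, so they can be subtracted; the nonnegative [g - f]
    with zero integral then vanishes almost everywhere. *)
Lemma le_integral_eq_ae (f g : T -> R) :
  mu.-integrable [set: T] (EFin \o f) -> mu.-integrable [set: T] (EFin \o g) ->
  (forall w, f w <= g w) ->
  (\int[mu]_w (f w)%:E = \int[mu]_w (g w)%:E)%E <->
  {ae mu, forall w, f w = g w}.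
Proof.
move=> fi gi fg; have mf := measurable_int mu fi; have mg := measurable_int mu gi.
split=> [fgE|fgae]; last first.
  by apply: ae_eq_integral => //; apply: filterS fgae => w /= -> _.
have : (\int[mu]_w `|(EFin \o (g \- f)%R) w| = 0)%E.
  under eq_integral do rewrite gee0_abs ?lee_fin ?subr_ge0// /= EFinB.
  by rewrite integralB_EFin// fgE subee// integrable_fin_num.
move/(ae_eq_integral_abs mu measurableT) => /(_ _)[].
  by apply/measurable_EFinP; apply: measurable_funB; apply/measurable_EFinP.
move=> N [mN N0 sN]; exists N; split => // w nfg; apply: sN => /= /(_ I) [].
by move/eqP; rewrite subr_eq0 => /eqP e; apply: nfg.
Qed.

Context (k : scalar_kind) (p : R).
Hypothesis p0 : 0 < p.
Implicit Types f g : T -> scalars R k.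

Lemma measurable_scalar_parts f : measurable_scalar_fun f ->
  measurable_fun [set: T] (@scalar_re R k \o f) /\
  measurable_fun [set: T] (@scalar_im R k \o f).
Proof.
rewrite /scalar_re /scalar_im /measurable_scalar_fun.
by case: k f => [|] f mf //; split => //; exact: measurable_cst.
Qed.

Lemma Lp_norm_powR f :
  (Lp_norm mu p f `^ p = \int[mu]_w (modulus (f w) `^ p)%:E)%E.
Proof.
rewrite /Lp_norm poweR_Lnorm ?gt_eqF//; apply: eq_integral => w _.
by rewrite gee0_abs ?lee_fin ?modulus_ge0.
Qed.

Lemma measurable_modulusB_powR f g :
  measurable_scalar_fun f -> measurable_scalar_fun g ->
  measurable_fun [set: T] (fun w => modulus (f w - g w) `^ p).
Proof.
move=> /measurable_scalar_parts[f1 f2] /measurable_scalar_parts[g1 g2].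
under eq_fun do rewrite modulus_powR ?gt_eqF// scalar_reB scalar_imB.
apply: (measurableT_comp (measurable_powR _)).
by apply: measurable_funD; apply: measurable_funX; apply: measurable_funB.
Qed.

Lemma integrable_modulus_powR f : in_Lp mu p f ->
  mu.-integrable [set: T] (fun w => (modulus (f w) `^ p)%:E).
Proof.
move=> [mf foo]; apply/integrableP; split.
  apply/measurable_EFinP; have := measurable_scalar_parts mf => -[f1 f2].
  under eq_fun do rewrite modulus_powR ?gt_eqF//.
  apply: (measurableT_comp (measurable_powR _)).
  by apply: measurable_funD; apply: measurable_funX.
under eq_integral do rewrite gee0_abs ?lee_fin ?powR_ge0//.
by rewrite -Lp_norm_powR poweR_lty.
Qed.

Lemma integrable_modulusB_powR f g : in_Lp mu p f -> in_Lp mu p g ->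
  mu.-integrable [set: T] (fun w => (modulus (f w - g w) `^ p)%:E).
Proof.
move=> fL gL; have [mf _] := fL; have [mg _] := gL.
apply: (@le_integrable _ _ _ mu _ measurableT _ (fun w => (2 `^ p)%:E *
  ((modulus (f w) `^ p)%:E + (modulus (g w) `^ p)%:E))%E).
- by apply/measurable_EFinP; exact: measurable_modulusB_powR.
- move=> w _; rewrite -EFinD -EFinM /= lee_fin !ger0_norm ?powR_ge0 ?mulr_ge0//;
    last by rewrite addr_ge0 ?powR_ge0.
  by rewrite modulusB_powR_le// ltW.
- by apply: integrableZl => //; apply: integrableD => //; exact: integrable_modulus_powR.
Qed.

(** The predicate [P] covers both the sums over [i < j] and the full double sum. *)
Lemma integral_EFin_sum (I J : finType) (P : I -> pred J) (h : I -> J -> T -> R) :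
  (forall i j, mu.-integrable [set: T] (EFin \o h i j)) ->
  mu.-integrable [set: T] (EFin \o (fun w => \sum_i \sum_(j | P i j) h i j w)) /\
  (\int[mu]_w (\sum_i \sum_(j | P i j) h i j w)%:E =
   \sum_i \sum_(j | P i j) \int[mu]_w (h i j w)%:E)%E.
Proof.
move=> hi.
have E : EFin \o (fun w => \sum_i \sum_(j | P i j) h i j w) =
    (fun w => \sum_i \sum_(j | P i j) (EFin \o h i j) w)%E.
  apply/funext => w /=; rewrite -sumEFin; apply: eq_bigr => i _.
  by rewrite sumEFin.
have hi1 i : mu.-integrable [set: T] (fun w => \sum_(j | P i j) (EFin \o h i j) w)%E.
  exact: integrable_sum.
rewrite -[X in X = _]/(\int[mu]_w (EFin \o (fun w => \sum_i \sum_(j | P i j) h i j w)%R) w)%E.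
rewrite E; split; first exact: integrable_sum.
by rewrite integral_sum//; apply: eq_bigr => i _; rewrite integral_sum.
Qed.

End MeasureLevel.

Theorem corollary4p8 (R : realType) (k : scalar_kind)
    (d : measure_display) (T : measurableType d)
    (mu : {measure set T -> \bar R}) (p : R) (n : nat)
    (x y : 'I_n -> T -> scalars R k)
    (p_gt0 : 0 < p) (p_lt2 : p < 2)
    (mu_nontrivial : (0 < mu [set: T])%E)
    (dim_ge2 : Lp_dim_ge2 k mu p)
    (x_Lp : forall j, in_Lp mu p (x j))
    (y_Lp : forall i, in_Lp mu p (y i))
    (non_degenerate : ~ degenerate mu x y) :
  (\sum_(j1 < n) \sum_(j2 < n | (j1 < j2)%N)
      Lp_norm mu p (fun w => (x j1 w - x j2 w)%R) `^ p +
   \sum_(i1 < n) \sum_(i2 < n | (i1 < i2)%N)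
      Lp_norm mu p (fun w => (y i1 w - y i2 w)%R) `^ p =
   \sum_(j < n) \sum_(i < n)
      Lp_norm mu p (fun w => (x j w - y i w)%R) `^ p)%E
  <->
  {ae mu, forall w,
     identical_numerical_sets (fun j => x j w) (fun i => y i w)}.
Proof.
have p02 : 0 < p < 2 by rewrite p_gt0.
have [Ax intx] := integral_EFin_sum (fun i j : 'I_n => (i < j)%N)
  (fun i j => integrable_modulusB_powR p_gt0 (x_Lp i) (x_Lp j)).
have [Ay inty] := integral_EFin_sum (fun i j : 'I_n => (i < j)%N)
  (fun i j => integrable_modulusB_powR p_gt0 (y_Lp i) (y_Lp j)).
have [Axy intxy] := integral_EFin_sum (fun _ _ : 'I_n => true)
  (fun i j => integrable_modulusB_powR p_gt0 (x_Lp i) (y_Lp j)).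
under eq_bigr do under eq_bigr do rewrite Lp_norm_powR//.
under [X in (_ + X)%E = _]eq_bigr do under eq_bigr do rewrite Lp_norm_powR//.
under [X in _ = X]eq_bigr do under eq_bigr do rewrite Lp_norm_powR//.
(* Each side becomes the integral of a pointwise energy, to be compared through [energy_le]. *)
rewrite -intx -inty -intxy -integralD//.
have := @le_integral_eq_ae R d T mu
  (fun w => intra_energy p (x ^~ w) + intra_energy p (y ^~ w))
  (fun w => cross_energy p (x ^~ w) (y ^~ w)) _ Axy (fun w => energy_le _ _ p02).
move=> /(_ (integrableD measurableT Ax Ay)) eqae.
(* Equality of the energies at a point is equivalent to identity of the numerical sets there, so
   both almost-everywhere statements agree. *)
apply: (iff_trans eqae); split; apply: filterS => w /energy_eqP; exact.
Qed.
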